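(* Let $\mathcal{D}=(\Omega,\mathcal{B})$ be a supersimple $2$-$(n,4,\lambda)$ design satisfying property $(\triangle)$, such that $(\Omega,\mathcal{C})$ is a regular two-graph where $\mathcal{C}$ is the set of collinear triples, and suppose $n>2\lambda+2$. Let $\infty\in\Omega$, $G:=\mathcal{L}_\infty(\mathcal{D})$, and $\mathcal{E}:=\{[a,b]\mid a,b\in\Omega\}$. Then: (a) $(G,\mathcal{E})$ is a $3$-transposition group; (b) $G$ is a $2$-primitive subgroup of $\operatorname{Sym}(\Omega)$; (c) $Z(G)=1$; (d) $\mathcal{E}$ is a conjugacy class in $G$.
   Context: A $2$-$(n,4,\lambda)$ design $(\Omega,\mathcal{B})$: $n$ points, a multiset of $4$-subsets (lines), every $2$-subset in exactly $\lambda$ lines; supersimple: distinct lines meet in at most two points. For distinct $a,b$ with lines $\{a,b,a_i,b_i\}$ through them, $[a,b]:=(a,b)\prod_i(a_i,b_i)$; $[a,a]:=1$. Permutations act on the right, products composed left to right; $[a_0,\dots,a_k]:=[a_0,a_1]\cdots[a_{k-1},a_k]$; $\mathcal{L}_\infty(\mathcal{D})$ = move sequences starting at $\infty$. Property $(\triangle)$: if $B_1,B_2\in\mathcal{B}$ with $|B_1\cap B_2|=2$ then $B_1\triangle B_2\in\mathcal{B}$. Regular two-graph: $(\Omega,\mathcal{C})$ is a $2$-$(n,3,\mu)$ design with every $4$-subset containing $0,2$ or $4$ members of $\mathcal{C}$. A $3$-transposition group: a pair $(G,\mathcal{E})$, $\mathcal{E}$ a set of involutions with $G=\langle\mathcal{E}\rangle$,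 $\mathcal{E}$ a union of $G$-conjugacy classes, $gh$ of order $1,2$ or $3$ for $g,h\in\mathcal{E}$. A permutation group is $2$-primitive if it is transitive and a point stabilizer is primitive on the remaining points.
   Formalization: The set E is taken as {[a,b] : a ≠ b in Ω}; with a = b allowed, [a,a] = 1 would lie in E, so E would be neither a set of involutions nor a single conjugacy class, and (a) and (d) would fail. *)

(* Defs.v *)
From mathcomp Require Import all_boot all_fingroup all_solvable.
Set Implicit Arguments. Unset Strict Implicit. Unset Printing Implicit Defensive.

Section Designs.
Variable T : finType.
Implicit Types (B C : {set {set T}}) (lam : nat).

(* 2-(n,4,lam) design on the point set T (n = #|T|); lines form a set, which is
   harmless since supersimplicity excludes repeated lines. *)
Definition design_2_4 B lam :=
  (forall L, L \in B -> #|L| = 4) /\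
  (forall x y : T, x != y -> #|[set L in B | (x \in L) && (y \in L)]| = lam).

Definition supersimple B :=
  forall L1 L2, L1 \in B -> L2 \in B -> L1 != L2 -> #|L1 :&: L2| <= 2.

Definition prop_triangle B :=
  forall L1 L2, L1 \in B -> L2 \in B -> #|L1 :&: L2| = 2 ->
    (L1 :\: L2) :|: (L2 :\: L1) \in B.

Definition collinear_triples B : {set {set T}} :=
  [set c : {set T} | (#|c| == 3) && [exists L in B, c \subset L]].

Definition regular_two_graph C :=
  (forall c, c \in C -> #|c| = 3) /\
  (exists mu : nat, forall x y : T, x != y ->
       #|[set c in C | (x \in c) && (y \in c)]| = mu) /\
  (forall S : {set T}, #|S| = 4 -> #|[set c in C | c \subset S]| \in [:: 0; 2; 4]).

Definition other_pair_tperm (a b : T) (L : {set T}) : {perm T} :=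
  let R := L :\ a :\ b in
  let x := odflt a [pick z in R] in
  let y := odflt a [pick z in R :\ x] in
  tperm x y.

Definition move B (a b : T) : {perm T} :=
  if a == b then 1%g
  else (tperm a b * \prod_(L in B | (a \in L) && (b \in L)) other_pair_tperm a b L)%g.

Fixpoint moves B (a : T) (s : seq T) : {perm T} :=
  match s with
  | [::] => 1%g
  | b :: s' => (move B a b * moves B b s')%g
  end.

Definition move_set B : {set {perm T}} :=
  [set move B ab.1 ab.2 | ab in [set ab : T * T | ab.1 != ab.2]].

End Designs.

Definition three_transposition_group (gT : finGroupType) (G E : {set gT}) :=
  [/\ G = <<E>>%g,
      (forall e, e \in E -> #[e]%g = 2),
      (forall g e, g \in G -> e \in E -> (e ^ g)%g \in E) &
      (forall e f, e \in E -> f \in E -> #[(e * f)%g]%g \in [:: 1; 2; 3])].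

Definition two_primitive (T : finType) (G : {set {perm T}}) :=
  [transitive G, on [set: T] | 'P] /\
  (forall x : T, [primitive 'C_G[x | 'P], on [set~ x] | 'P]).

(* Main.v *)
Require Import Defs.
From mathcomp Require Import all_boot all_fingroup all_solvable.

(** Property (triangle) gives [a,b] = [c,d] for every line {a,b,c,d}, and together
    with the parity condition of the two-graph it makes every [a,b] an automorphism
    of the design; hence [a,b]^h = [a^h,b^h] for all h in G.  If c is not collinear
    with a, b, then [c,a][a,b][b,c] = [a,b], so G is the group generated by E; the
    same relation gives order 3 for [a,b][a,c], and the other products of two moves
    have order at most 2.

    For fixed x, write a ~ b when x, a, b are distinct and not collinear; then [a,b]
    fixes x.  As n > 2 lam + 2, the graph ~ has diameter at most 2, so G is
    2-transitive, which gives (c) and (d).  A nontrivial block of the stabilizer of x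
    would contain two points with the same neighbours in ~, whereas parity and
    regularity show that each of two nonadjacent points has a private neighbour. *)
Set Implicit Arguments. Unset Strict Implicit. Unset Printing Implicit Defensive.

(** * Lines as quadruples of points, and collinear triples *)

Section Lines.
Variables (T : finType) (B : {set {set T}}).

Definition line (a b c d : T) : bool := [set a; b; c; d] \in B.
Definition coll (a b c : T) : bool := [exists d, line a b c d].

(** [line_perm H] proves a [line] goal that lists the points of the line [H] in another order. *)
Ltac line_perm H := move: (H); rewrite /line;
  match goal with |- is_true (?S \in _) -> is_true (?S' \in _) =>
    suff -> : S = S' by []; apply/setP=> ?; rewrite !inE;
    repeat match goal with |- context [?z == ?w] => case: (z == w) end; done
  end.

Lemma lineC12 a b c d : line a b c d = line b a c d.
Proof. by apply/idP/idP=> L; line_perm L. Qed.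

Lemma lineC34 a b c d : line a b c d = line a b d c.
Proof. by apply/idP/idP=> L; line_perm L. Qed.

Lemma lineC23 a b c d : line a b c d = line a c b d.
Proof. by apply/idP/idP=> L; line_perm L. Qed.

Lemma collC12 a b c : coll a b c = coll b a c.
Proof. by apply: eq_existsb => d; rewrite lineC12. Qed.

Lemma collC23 a b c : coll a b c = coll a c b.
Proof. by apply: eq_existsb => d; rewrite lineC23. Qed.

Lemma line_coll a b c d : line a b c d -> coll a b c.
Proof. by move=> abcd; apply/existsP; exists d. Qed.

Lemma set4_expand (a b c : T) (L : {set T}) :
  #|L| = 4 -> uniq [:: a; b; c] -> [&& a \in L, b \in L & c \in L] ->
  exists d, L = [set a; b; c; d].
Proof.
move=> cL /=; rewrite !inE negb_or !andbT => /andP[/andP[ab ac] bc] /and3P[aL bL cL'].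
have: #|L :\ a :\ b :\ c| == 1.
  move: cL; rewrite (cardsD1 a L) aL (cardsD1 b (L :\ a)) (cardsD1 c (L :\ a :\ b)).
  by rewrite !inE bL cL' (eq_sym b a) (eq_sym c a) (eq_sym c b) ab ac bc /= !add1n => -[->].
case/cards1P=> d dE; exists d; apply/setP=> z.
have := congr1 (fun S : {set T} => z \in S) dE; rewrite !inE.
case: (eqVneq z a) => [->|_] //=; case: (eqVneq z b) => [->|_] //=.
by case: (eqVneq z c) => [->|_].
Qed.

Lemma uniq4P (a b c d : T) :
  reflect [/\ a != b, a != c, a != d, b != c & b != d /\ c != d] (uniq [:: a; b; c; d]).
Proof.
rewrite /= !inE !negb_or !andbT -!andbA.
by apply: (iffP and5P) => [[? ? ? ? /andP[]]|[? ? ? ? []]] ? ?; split=> //; apply/andP.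
Qed.

Lemma card_set3 (a b c : T) : uniq [:: a; b; c] -> #|[set a; b; c]| = 3.
Proof. by move/card_uniqP=> /= <-; apply: eq_card => z; rewrite !inE !orbA. Qed.

Lemma card_set4_uniq (a b c d : T) : #|[set a; b; c; d]| = 4 -> uniq [:: a; b; c; d].
Proof.
move=> h; apply/card_uniqP; rewrite /= -h; apply: eq_card => z.
by rewrite !inE !orbA.
Qed.

Lemma card_set4 (a b c d : T) : uniq [:: a; b; c; d] -> #|[set a; b; c; d]| = 4.
Proof.
move/card_uniqP=> /= <-; apply: eq_card => z.
by rewrite !inE !orbA.
Qed.

Variable lam : nat.
Hypothesis B_design : design_2_4 B lam.
Hypothesis B_simple : supersimple B.
Hypothesis B_triangle : prop_triangle B.

Lemma line_uniq a b c d : line a b c d -> uniq [:: a; b; c; d].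
Proof. by move=> h; apply: card_set4_uniq; apply: B_design.1. Qed.

Lemma line_neq a b c d : line a b c d ->
  [/\ a != b, a != c, a != d, b != c & b != d /\ c != d].
Proof. by move/line_uniq/uniq4P. Qed.

Lemma line_eq a b c (L M : {set T}) : L \in B -> M \in B -> uniq [:: a; b; c] ->
  [&& a \in L, b \in L & c \in L] -> [&& a \in M, b \in M & c \in M] -> L = M.
Proof.
move=> LB MB u /and3P[aL bL cL] /and3P[aM bM cM].
apply/eqP; apply: contraT => LM; have := B_simple LB MB LM.
suff: [set a; b; c] \subset L :&: M.
  move=> /subset_leq_card h1 h2; have := leq_trans h1 h2.
  by rewrite card_set3.
by apply/subsetP=> z; rewrite !inE => /orP[/orP[]|] /eqP->; apply/andP.
Qed.

Lemma line_inj a b c d e : line a b c d -> line a b c e -> d = e.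
Proof.
move=> hd he; have /uniq4P[ab ac ad bc [bd cd]] := line_uniq hd.
have E : [set a; b; c; d] = [set a; b; c; e].
  by apply: (@line_eq a b c) => //; rewrite /= ?inE ?eqxx ?orbT ?negb_or ?ab ?ac ?bc.
have : d \in [set a; b; c; e] by rewrite -E !inE eqxx orbT.
rewrite !inE (eq_sym d a) (eq_sym d b) (eq_sym d c).
by rewrite (negPf ad) (negPf bd) (negPf cd) => /eqP.
Qed.

(** The two lines must meet in exactly [a], [b]. The hypotheses keep [c] off the second line, and
    then [d] is off it too, because three points of a line determine the fourth. *)
Lemma line_triangle a b c d e f : line a b c d -> line a b e f ->
  c != e -> c != f -> line c d e f.
Proof.
move=> h1 h2 ce cf.
have de : d != e.
  apply: contraNneq cf => de; move: h1; rewrite de lineC34 => h1.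
  by rewrite (line_inj h2 h1).
have df : d != f.
  apply: contraNneq ce => df; move: h1; rewrite df lineC34 => h1.
  by move: h2; rewrite lineC34 => h2; rewrite (line_inj h2 h1).
have [ab ac ad bc [bd cd]] := line_neq h1.
have [_ ae af be [bf ef]] := line_neq h2.
have neq := (negPf ab, negPf ac, negPf ad, negPf bc, negPf bd, negPf cd,
  (negPf ae, negPf af, negPf be, negPf bf, negPf ef, negPf ce, negPf cf, negPf de, negPf df)).
have I : [set a; b; c; d] :&: [set a; b; e; f] = [set a; b].
  apply/setP=> z; rewrite !inE.
  case: (eqVneq z a) => //= _; case: (eqVneq z b) => //= _.
  by case: (eqVneq z c) => [->|_] /=; [rewrite !neq | case: (eqVneq z d) => [->|_] //=; rewrite !neq].
have := B_triangle h1 h2; rewrite I cards2 ab => /(_ erefl).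
congr (_ \in B); apply/setP=> z; rewrite !inE.
case: (eqVneq z a) => [->|_] /=; first by rewrite !neq.
case: (eqVneq z b) => [->|_] /=; first by rewrite !neq.
case: (eqVneq z c) => [->|_] /=; first by rewrite !neq.
case: (eqVneq z d) => [->|_] /=; first by rewrite !neq.
by case: (z == e); case: (z == f).
Qed.

Lemma coll_neq a b c : coll a b c -> [/\ a != b, a != c & b != c].
Proof. by case/existsP=> d /line_neq[]. Qed.

Lemma collE a b c : uniq [:: a; b; c] ->
  coll a b c = [exists L in B, [set a; b; c] \subset L].
Proof.
move=> u; apply/existsP/exists_inP => [[d abcd]|[L LB /subsetP sL]].
  exists [set a; b; c; d] => //; apply/subsetP=> z; rewrite !inE => ->//.
have [|d dE] := set4_expand (B_design.1 _ LB) u.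
  by rewrite !sL // !inE eqxx ?orbT.
by exists d; rewrite /line -dE.
Qed.

Lemma card_lines3 a b c : uniq [:: a; b; c] ->
  #|[set L in B | [&& a \in L, b \in L & c \in L]]| = coll a b c.
Proof.
move=> u; case: (boolP (coll a b c)) => [/existsP[d abcd]|abc].
  apply/eqP; apply/cards1P; exists [set a; b; c; d]; apply/setP=> L; rewrite !inE.
  apply/andP/eqP=> [[LB h]|->]; last by rewrite !inE !eqxx !orbT.
  by apply: (line_eq LB abcd u) => //; rewrite !inE !eqxx !orbT.
apply/eqP; rewrite cards_eq0 -subset0; apply/subsetP=> L; rewrite !inE => /andP[LB h].
case/negP: abc; rewrite collE //; apply/exists_inP; exists L => //.
by case/and3P: h => *; apply/subsetP=> z; rewrite !inE => /orP[/orP[]|] /eqP->.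
Qed.

(** Double counting of pairs (c, L) with L a line through [a], [b]: each of the [lam] lines has two
    further points, and supersimplicity puts each c on at most one of them. *)
Lemma card_coll a b : a != b -> #|[set c | coll a b c]| = 2 * lam.
Proof.
move=> ab; pose F := [set L in B | (a \in L) && (b \in L)].
have cF : #|F| = lam := B_design.2 _ _ ab.
transitivity (\sum_(c in ~: [set a; b]) \sum_(L in F) (c \in L))%N.
  rewrite -sum1dep_card big_mkcond [RHS]big_mkcond; apply: eq_bigr => c _.
  rewrite !inE negb_or; case: (altP (c =P a)) => [->|ca] /=.
    by case: ifP => // /coll_neq[_]; rewrite eqxx.
  case: (altP (c =P b)) => [->|cb] /=.
    by case: ifP => // /coll_neq[_ _]; rewrite eqxx.
  have u : uniq [:: a; b; c] by rewrite /= !inE negb_or ab eq_sym ca eq_sym cb.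
  rewrite -big_mkcondr /= sum1dep_card.
  rewrite -[RHS](_ : nat_of_bool (coll a b c) = _); first by case: (coll a b c).
  rewrite -card_lines3 //; apply: eq_card => L; rewrite !inE -!andbA.
  by [].
rewrite exchange_big /= -cF mulnC -sum_nat_const; apply: eq_bigr => L.
rewrite !inE => /and3P[LB aL bL].
rewrite -big_mkcondr /= sum1dep_card.
have := B_design.1 _ LB; rewrite (cardsD1 a) aL (cardsD1 b (L :\ a)) !inE eq_sym ab bL /=.
rewrite !add1n => -[<-]; apply: eq_card => z; rewrite !inE negb_or.
by case: (z == a); case: (z == b).
Qed.

(** * The parity condition of the two-graph *)

Hypothesis B_twograph : regular_two_graph (collinear_triples B).

(** The 3-subsets of the 4-set [S] are the sets [S :\ x], so the members of the two-graph inside [S]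
    are counted by their omitted points; the count is 0, 2 or 4, hence even. *)
Lemma two_graph_parity a b c d : uniq [:: a; b; c; d] ->
  coll a b c (+) coll a b d (+) coll a c d (+) coll b c d = false.
Proof.
move=> u; have /uniq4P[ab ac ad bc [bd cd]] := u.
pose S := [set a; b; c; d].
have cS : #|S| = 4 := card_set4 u.
have [_ [_ /(_ S cS)]] := B_twograph.
have -> : [set t in collinear_triples B | t \subset S]
        = (fun x => S :\ x) @: [set x in S | [exists L in B, S :\ x \subset L]].
  apply/setP=> t; rewrite !inE; apply/idP/imsetP.
    case/andP=> /andP[/eqP ct tL] tS.
    have: #|S :\: t| == 1 by rewrite cardsD (setIidPr tS) cS ct.
    case/cards1P=> x xE.
    have tE : t = S :\ x by rewrite -xE setDDr setDv set0U (setIidPr tS).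
    exists x => //; rewrite inE -tE tL andbT.
    by have : x \in S :\: t; [rewrite xE inE | rewrite inE => /andP[]].
  case=> x; rewrite inE => /andP[xS xL] ->; rewrite xL subsetDl !andbT.
  by move: cS; rewrite (cardsD1 x) xS add1n => -[->].
rewrite card_in_imset; last first.
  move=> x y; rewrite !inE => /andP[xS _] /andP[yS _] E.
  have: x \notin S :\ y by rewrite -E !inE eqxx.
  by rewrite !inE xS andbT negbK => /eqP.
have -> : #|[set x in S | [exists L in B, S :\ x \subset L]]|
   = (coll b c d + coll a c d + coll a b d + coll a b c)%N.
  rewrite -sum1dep_card big_mkcondr /=.
  rewrite (eq_bigl (mem [:: a; b; c; d])); last by move=> z; rewrite !inE !orbA.
  rewrite -big_uniq //= !big_cons big_nil addn0 !addnA.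
  have S1 : [set b; c; d] = S :\ a.
    apply/setP=> z; rewrite !inE; case: (eqVneq z a) => [->|_] //=.
    by rewrite (negPf ab) (negPf ac) (negPf ad).
  have S2 : [set a; c; d] = S :\ b.
    apply/setP=> z; rewrite !inE; case: (eqVneq z b) => [->|_] //=; last by rewrite orbF.
    by rewrite eq_sym (negPf ab) (negPf bc) (negPf bd).
  have S3 : [set a; b; d] = S :\ c.
    apply/setP=> z; rewrite !inE; case: (eqVneq z c) => [->|_] //=; last by rewrite orbF.
    by rewrite eq_sym (negPf ac) eq_sym (negPf bc) (negPf cd).
  have S4 : [set a; b; c] = S :\ d.
    apply/setP=> z; rewrite !inE; case: (eqVneq z d) => [->|_] //=; last by rewrite orbF.
    by rewrite eq_sym (negPf ad) eq_sym (negPf bd) eq_sym (negPf cd).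
  rewrite !collE ?S1 ?S2 ?S3 ?S4 /= ?inE ?negb_or ?ab ?ac ?ad ?bc ?bd ?cd //.
by case: (coll b c d); case: (coll a c d); case: (coll a b d); case: (coll a b c).
Qed.


(** * The moves as permutations of the points *)

Lemma other_pair_tpermE a b c d : line a b c d ->
  other_pair_tperm a b [set a; b; c; d] = tperm c d.
Proof.
move=> abcd; have [ab ac ad bc [bd cd]] := line_neq abcd.
rewrite /other_pair_tperm.
have -> : [set a; b; c; d] :\ a :\ b = [set c; d].
  apply/setP=> z; rewrite !inE.
  case: (eqVneq z a) => [->|_] /=; first by rewrite (negPf ac) (negPf ad) andbF.
  by case: (eqVneq z b) => [->|_] //=; rewrite (negPf bc) (negPf bd).
(* [pick] may return either of the two remaining points; both choices give the same
   transposition. *)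
case: pickP => [x|/(_ c)]; last by rewrite !inE eqxx.
rewrite !inE /=; case/orP=> /eqP-> {x}.
  have -> : [set c; d] :\ c = [set d].
    by apply/setP=> z; rewrite !inE; case: (eqVneq z c) => [->|_] //=; rewrite (negPf cd).
  by case: pickP => [y|/(_ d)]; rewrite !inE ?eqxx // => /eqP->.
have -> : [set c; d] :\ d = [set c].
  by apply/setP=> z; rewrite !inE; case: (eqVneq z d) => [->|_] /=; rewrite ?orbF // eq_sym (negPf cd).
by case: pickP => [y|/(_ c)]; rewrite !inE ?eqxx // => /eqP->; rewrite tpermC.
Qed.

Lemma line_expand a b L : L \in B -> a \in L -> b \in L -> a != b ->
  exists c d, L = [set a; b; c; d].
Proof.
move=> LB aL bL ab.
have: L :\ a :\ b != set0.
  rewrite -card_gt0; have := B_design.1 _ LB.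
  by rewrite (cardsD1 a) aL (cardsD1 b (L :\ a)) !inE bL eq_sym ab !add1n => -[->].
case/set0Pn=> c; rewrite !inE => /and3P[cb ca cL].
have [||d dE] := @set4_expand a b c L (B_design.1 _ LB).
- by rewrite /= !inE negb_or ab eq_sym ca eq_sym cb.
- by rewrite aL bL cL.
by exists c, d.
Qed.

Lemma prod_perm_fix (I : finType) (P : pred I) (F : I -> {perm T}) z :
  (forall i, P i -> F i z = z) -> (\prod_(i | P i) F i)%g z = z.
Proof.
move=> Fz; elim/big_rec: _ => [|i s Pi sz]; first by rewrite perm1.
by rewrite permM Fz.
Qed.

(** All factors other than [F i0] fix both [y] and [z], so the position of [F i0] in the product
    does not matter. *)
Lemma prod_perm_single (I : finType) (P : pred I) (F : I -> {perm T}) i0 y z :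
  P i0 -> F i0 y = z -> (forall i, P i -> i != i0 -> F i y = y /\ F i z = z) ->
  (\prod_(i | P i) F i)%g y = z.
Proof.
move=> Pi0 yz Fi.
have := index_enum_uniq I; have := mem_index_enum i0.
elim: (index_enum I) => // i r IH; rewrite inE big_cons /=.
case: (eqVneq i0 i) => [<- _|ne /= i0r] /andP[ir ur].
  rewrite Pi0 permM yz big_seq_cond.
  elim/big_rec: _ => [|j s /andP[jr Pj] sz]; first by rewrite perm1.
  by rewrite permM (Fi j Pj _).2 //; apply: contraNneq ir => <-.
by case: ifP => Pi; rewrite ?permM ?(Fi i Pi _).1 1?eq_sym //; apply: IH.
Qed.

Notation mv := (move B).

Lemma moveE a b : a != b -> mv a b =
  (tperm a b * \prod_(L in B | (a \in L) && (b \in L)) other_pair_tperm a b L)%g.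
Proof. by rewrite /move => /negPf->. Qed.

Lemma other_pair_fix a b L z : a != b -> [&& L \in B, a \in L & b \in L] ->
  z = a \/ z = b \/ z \notin L -> other_pair_tperm a b L z = z.
Proof.
move=> ab /and3P[LB aL bL] hz.
have [c [d LE]] := line_expand LB aL bL ab.
have abcd : line a b c d by rewrite /line -LE.
rewrite LE other_pair_tpermE //.
have [_ ac ad bc [bd cd]] := line_neq abcd.
case: hz => [->|[->|]].
- by rewrite tpermD // eq_sym.
- by rewrite tpermD // eq_sym.
by rewrite LE !inE !negb_or => /andP[/andP[_ zc] zd]; rewrite tpermD // eq_sym.
Qed.

Lemma move_l a b : mv a b a = b.
Proof.
case: (eqVneq a b) => [->|ab]; first by rewrite /move eqxx perm1.
rewrite moveE // permM tpermL; apply: prod_perm_fix => L hL.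
by apply: other_pair_fix => //; auto.
Qed.

Lemma move_r a b : mv a b b = a.
Proof.
case: (eqVneq a b) => [->|ab]; first by rewrite /move eqxx perm1.
rewrite moveE // permM tpermR; apply: prod_perm_fix => L hL.
by apply: other_pair_fix => //; auto.
Qed.

Lemma move_fix a b z : z != a -> z != b -> ~~ coll a b z -> mv a b z = z.
Proof.
move=> za zb abz; case: (eqVneq a b) => [->|ab]; first by rewrite /move eqxx perm1.
rewrite moveE // permM tpermD 1?eq_sym //; apply: prod_perm_fix => L hL.
apply: other_pair_fix => //; right; right; apply: contra abz => zL.
have /and3P[LB aL bL] := hL.
have u : uniq [:: a; b; z] by rewrite /= !inE negb_or ab eq_sym za eq_sym zb.
have [|d dE] := set4_expand (B_design.1 _ LB) u; first by rewrite aL bL.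
by apply/existsP; exists d; rewrite /line -dE.
Qed.

(** By supersimplicity no other line through [a], [b] contains [y] or [z], so a single factor acts
    on them. *)
Lemma move_line a b y z : line a b y z -> mv a b y = z.
Proof.
move=> abyz; have [ab ay az by_ [bz yz]] := line_neq abyz.
rewrite moveE // permM tpermD //.
apply: (@prod_perm_single _ _ _ [set a; b; y; z]).
- by apply/and3P; split=> //; rewrite !inE eqxx ?orbT.
- by rewrite other_pair_tpermE // tpermL.
move=> L /and3P[LB aL bL] ne.
by split; apply: other_pair_fix; rewrite ?LB ?aL ?bL //; right; right;
   apply: contra ne => yL; apply/eqP; [apply: (@line_eq a b y) | apply: (@line_eq a b z)] => //;
   rewrite /= ?inE ?negb_or ?ab ?ay ?az ?by_ ?bz ?eqxx ?orbT ?aL ?bL.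
Qed.
(** A view for case analysis: destructing [moveP] replaces [mv a b z] by its value in each case. *)
Variant move_spec a b z : T -> Prop :=
| MoveL of z = a : move_spec a b z b
| MoveR of z = b : move_spec a b z a
| MoveLine d of line a b z d : move_spec a b z d
| MoveFix of z != a & z != b & ~~ coll a b z : move_spec a b z z.

Lemma moveP a b z : move_spec a b z (mv a b z).
Proof.
case: (eqVneq z a) => [->|za]; first by rewrite move_l; constructor.
case: (eqVneq z b) => [->|zb]; first by rewrite move_r; constructor.
case: (boolP (coll a b z)) => [/existsP[d abzd]|abz].
  by rewrite (move_line abzd); constructor.
by rewrite move_fix //; constructor.
Qed.

Lemma moveC a b : mv a b = mv b a.
Proof.
apply/permP=> z; case: (moveP a b z) => [->|->|d abzd|za zb abz].
- by rewrite move_r.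
- by rewrite move_l.
- by rewrite (@move_line b a z d) // lineC12.
by rewrite move_fix // collC12.
Qed.

Lemma moveK a b : involutive (mv a b).
Proof.
move=> z; case: (moveP a b z) => [->|->|d abzd|za zb abz].
- exact: move_r.
- exact: move_l.
- by rewrite (@move_line a b d z) // lineC34.
exact: move_fix.
Qed.

Lemma moveM a b : (mv a b * mv a b = 1)%g.
Proof. by apply/permP=> z; rewrite permM moveK perm1. Qed.

Lemma line_coll_trans a b c d z : line a b c d -> z != c -> z != d ->
  coll a b z -> coll c d z.
Proof.
move=> abcd zc zd /existsP[w abzw]; apply: (@line_coll _ _ _ w).
by line_perm (line_triangle abzw abcd zc zd).
Qed.

(** On the line itself both moves act as (a b)(c d). Symmetric difference with it turns any other
    line through [a], [b] into a line through [c], [d] with the same remaining pair, and conversely,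
    so both moves swap the same pairs. *)
Lemma move_same a b c d : line a b c d -> mv a b = mv c d.
Proof.
move=> abcd; have cdab : line c d a b by line_perm abcd.
apply/permP=> z; case: (moveP c d z) => [->|->|w cdzw|zc zd cdz].
- exact: move_line.
- by apply: move_line; line_perm abcd.
- case: (eqVneq z a) cdzw => [-> cdaw|za cdzw].
    by rewrite move_l; apply: line_inj cdab cdaw.
  case: (eqVneq z b) cdzw => [-> cdbw|zb cdzw].
    by rewrite move_r; apply: (@line_inj c d b); first by line_perm abcd.
  by apply: move_line; line_perm (line_triangle cdzw cdab za zb).
case: (eqVneq z a) cdz => [->|za cdz]; first by rewrite (line_coll cdab).
case: (eqVneq z b) cdz => [->|zb cdz].
  by rewrite (@line_coll c d b a) //; line_perm abcd.
by apply: move_fix => //; apply: contra cdz; apply: line_coll_trans.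
Qed.

(** Any pair exchanged by a move can serve as its base pair. *)
Lemma move_moved a b z : mv a b z != z -> mv a b = mv z (mv a b z).
Proof.
case: (moveP a b z) => [->|->|d abzd|]; rewrite ?eqxx // => _.
  exact: moveC.
exact: move_same.
Qed.

(** * Moves are automorphisms of the design *)

Lemma line_swap a b x y z x' : line a x y z -> line a b x x' -> b != y -> b != z ->
  line b x' y z.
Proof.
move=> axyz abxx' b_y bz; have axbx' : line a x b x' by rewrite lineC23.
exact: line_triangle axbx' axyz b_y bz.
Qed.

(* Let k be the number of points among x, y, z collinear with a and b.  If
   k > 0, the symmetric difference with a line through a, b makes two of x, y, z
   collinear with b, so that parity excludes k = 2; if k = 0, parity makes b, x, y
   collinear, and a symmetric difference yields a line through a, b, z. *)
Lemma move_line_l a b x y z : line a x y z -> b != a -> b \notin [:: x; y; z] ->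
  line b (mv a b x) (mv a b y) (mv a b z).
Proof.
move=> axyz ba; rewrite !inE !negb_or => /and3P[bx b_y bz].
have [ax ay az xy [xz yz]] := line_neq axyz.
have axzy : line a x z y by rewrite lineC34.
have ayxz : line a y x z by rewrite lineC23.
have ayzx : line a y z x by line_perm axyz.
have azxy : line a z x y by line_perm axyz.
have azyx : line a z y x by line_perm axyz.
have uxy : uniq [:: a; b; x; y] by rewrite /= !inE !negb_or eq_sym ba ax ay bx b_y xy.
have uxz : uniq [:: a; b; x; z] by rewrite /= !inE !negb_or eq_sym ba ax az bx bz xz.
have uyz : uniq [:: a; b; y; z] by rewrite /= !inE !negb_or eq_sym ba ay az b_y bz yz.
have pxy := two_graph_parity uxy; have pxz := two_graph_parity uxz.
have pyz := two_graph_parity uyz.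
rewrite (line_coll axyz) in pxy; rewrite (line_coll axzy) in pxz.
rewrite (line_coll ayzx) in pyz.
have collx : coll a b x -> coll b y z.
  case/existsP=> x' abxx'; apply: (@line_coll _ _ _ x').
  by line_perm (line_swap axyz abxx' b_y bz).
have colly : coll a b y -> coll b x z.
  case/existsP=> y' abyy'; apply: (@line_coll _ _ _ y').
  by line_perm (line_swap ayxz abyy' bx bz).
have collz : coll a b z -> coll b x y.
  case/existsP=> z' abzz'; apply: (@line_coll _ _ _ z').
  by line_perm (line_swap azxy abzz' bx b_y).
case: (boolP (coll a b x)) collx pxy pxz => [cx /(_ isT) byz|ncx _] pxy pxz;
case: (boolP (coll a b y)) colly pxy pyz => [cy /(_ isT) bxz|ncy _] pxy pyz;
case: (boolP (coll a b z)) collz pxz pyz => [cz /(_ isT) bxy|ncz _] pxz pyz;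
rewrite ?byz ?bxz ?bxy // in pxy pxz pyz.
(* All three points are moved: the lines {b,y,x',z} and {b,y,a,y'} give {a,z,x',y'}, and its
   symmetric difference with {a,z,b,z'} is the required image. *)
- have [x' abxx'] := existsP cx; have [y' abyy'] := existsP cy; have [z' abzz'] := existsP cz.
  rewrite (move_line abxx') (move_line abyy') (move_line abzz').
  have [_ _ ax' _ [bx' _]] := line_neq abxx'.
  have x'y' : x' != y'.
    apply: contraNneq xy => E; rewrite E lineC34 in abxx'; rewrite lineC34 in abyy'.
    exact/eqP/(line_inj abxx' abyy').
  have x'z' : x' != z'.
    apply: contraNneq xz => E; rewrite E lineC34 in abxx'; rewrite lineC34 in abzz'.
    exact/eqP/(line_inj abxx' abzz').
  have bx'yz := line_swap axyz abxx' b_y bz.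
  have byx'z : line b y x' z by rewrite lineC23.
  have byay' : line b y a y' by line_perm abyy'.
  have azx'y' : line a z x' y'.
    have := line_triangle byx'z byay'; rewrite eq_sym => /(_ ax' x'y') h.
    by line_perm h.
  have azbz' : line a z b z' by line_perm abzz'.
  have := line_triangle azx'y' azbz'; rewrite eq_sym => /(_ bx' x'z') h.
  by line_perm h.
- have [x' abxx'] := existsP cx; rewrite (move_line abxx') !move_fix 1?eq_sym //.
  exact: line_swap axyz abxx' b_y bz.
- have [y' abyy'] := existsP cy.
  rewrite (move_line abyy') (@move_fix _ _ x) 1?eq_sym // (@move_fix _ _ z) 1?eq_sym //.
  by line_perm (line_swap ayxz abyy' bx bz).
- have [z' abzz'] := existsP cz.
  rewrite (move_line abzz') (@move_fix _ _ x) 1?eq_sym // (@move_fix _ _ y) 1?eq_sym //.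
  by line_perm (line_swap azxy abzz' bx b_y).
have: coll b x y by move: pxy; case: coll.
case/existsP=> w bxyw; case/negP: ncz.
have xyaz : line x y a z by line_perm axyz.
have xybw : line x y b w by line_perm bxyw.
have h := line_triangle xybw xyaz ba bz.
by apply: (@line_coll _ _ _ w); line_perm h.
Qed.

(** What remains is [b = a], where the move is trivial, and [b] on the line, where the move permutes
    the four points of the line. *)
Lemma move_line_through a b x y z : line a x y z ->
  line (mv a b a) (mv a b x) (mv a b y) (mv a b z).
Proof.
move=> axyz; case: (eqVneq b a) => [->|ba]; first by rewrite /move eqxx !perm1.
case: (boolP (b \in [:: x; y; z])) => [|bL]; last by rewrite move_l move_line_l.
rewrite !inE => /or3P[] /eqP bE; subst b; rewrite move_l move_r.
- rewrite (move_line axyz) (@move_line a x z y); last by line_perm axyz.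
  by line_perm axyz.
- rewrite (@move_line a y x z); last by line_perm axyz.
  rewrite (@move_line a y z x); last by line_perm axyz.
  by line_perm axyz.
rewrite (@move_line a z x y); last by line_perm axyz.
rewrite (@move_line a z y x); last by line_perm axyz.
by line_perm axyz.
Qed.

(* A line avoiding a is the symmetric difference of two lines through a. *)
Lemma move_line_avoid a b x y z w : line x y z w -> a \notin [:: x; y; z; w] ->
  coll a x y -> line (mv a b x) (mv a b y) (mv a b z) (mv a b w).
Proof.
rewrite !inE !negb_or => xyzw /and4P[ax ay az aw] /existsP[u axyu].
have [_ xz xw yz [yw zw]] := line_neq xyzw.
have xyau : line x y a u by line_perm axyu.
have auzw := line_triangle xyau xyzw az aw.
have h1 := move_line_through b axyu; have h2 := move_line_through b auzw.
have h1' : line (mv a b a) (mv a b u) (mv a b x) (mv a b y) by line_perm h1.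
by apply: (line_triangle h1' h2); rewrite (inj_eq perm_inj).
Qed.

Definition line_aut (h : {perm T}) :=
  forall a b c d, line (h a) (h b) (h c) (h d) = line a b c d.

(** If [a] is off a line {x,y,z,w}, then since x, y, z are collinear, parity on {a,x,y,z} makes [a]
    collinear with two of them, as [move_line_avoid] requires. The converse direction holds because
    moves are involutions. *)
Lemma move_aut a b : line_aut (mv a b).
Proof.
have sub x y z w : line x y z w -> line (mv a b x) (mv a b y) (mv a b z) (mv a b w).
  move=> L; case: (boolP (a \in [:: x; y; z; w])) => [|aL].
    rewrite !inE => /or4P[] /eqP E; rewrite -E in L *.
    - exact: move_line_through.
    - have L' : line a x z w by line_perm L.
      by line_perm (move_line_through b L').
    - have L' : line a x y w by line_perm L.
      by line_perm (move_line_through b L').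
    have L' : line a x y z by line_perm L.
    by line_perm (move_line_through b L').
  have [xy xz _ yz _] := line_neq L.
  have u : uniq [:: a; x; y; z].
    move: aL; rewrite !inE !negb_or => /and4P[ax ay az _].
    by rewrite /= !inE !negb_or ax ay az xy xz yz.
  have := two_graph_parity u; rewrite (line_coll L).
  case: (boolP (coll a x y)) => [cxy _|_]; first exact: move_line_avoid.
  case: (boolP (coll a x z)) => [cxz _|_].
    have L' : line x z y w by line_perm L.
    have aL' : a \notin [:: x; z; y; w] by move: aL; rewrite !inE (orbCA (a == y)).
    by line_perm (move_line_avoid b L' aL' cxz).
  case: (boolP (coll a y z)) => // cyz _.
  have L' : line y z x w by line_perm L.
  have aL' : a \notin [:: y; z; x; w].
    by move: aL; rewrite !inE (orbCA (a == x)) (orbCA (a == x)).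
  by line_perm (move_line_avoid b L' aL' cyz).
move=> x y z w; apply/idP/idP=> [/sub|]; last exact: sub.
by rewrite !moveK.
Qed.

(** * Conjugation of moves, and closure of move sequences under products *)

Lemma move_refl a : mv a a = 1%g.
Proof. by rewrite /move eqxx. Qed.

Lemma line_aut_coll h a b c : line_aut h -> coll (h a) (h b) (h c) = coll a b c.
Proof.
move=> hA; apply/existsP/existsP=> [[d hd]|[d hd]]; last by exists (h d); rewrite hA.
by exists ((h^-1)%g d); rewrite -hA permKV.
Qed.

(** An automorphism carries the lines through [a], [b] to those through [h a], [h b]. Each point is
    written as the image under [h] of a point, so that the cases of [moveP] apply. *)
Lemma move_conj h a b : line_aut h -> (mv a b ^ h)%g = mv (h a) (h b).
Proof.
move=> hA; apply/permP=> z; rewrite -[z](permKV h); move: ((h^-1)%g z) => {}z.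
rewrite permJ; case: (moveP a b z) => [->|->|d abzd|za zb abz].
- by rewrite move_l.
- by rewrite move_r.
- by rewrite (@move_line _ _ _ (h d)) // hA.
by rewrite move_fix ?(inj_eq perm_inj) // line_aut_coll.
Qed.

Lemma moveV a b : ((mv a b)^-1)%g = mv a b.
Proof. by apply/eqP; rewrite eq_invg_mul moveM. Qed.

Lemma move_braid a b c : a != b -> a != c -> ~~ coll a b c ->
  (mv a b ^ mv b c)%g = mv a c.
Proof.
move=> ab ac abc; rewrite move_conj; last exact: move_aut.
by rewrite move_l move_fix // collC23 collC12.
Qed.

(** Two uses of [move_braid]: the first rewrites the product as the conjugate of [y,c] by [c,x], the
    second evaluates this conjugate. *)
Lemma move_loop c x y : c != x -> c != y -> x != y -> ~~ coll c x y ->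
  (mv c x * (mv x y * mv y c))%g = mv x y.
Proof.
move=> cx cy xy cxy.
rewrite [(mv x y * _)%g]conjgC move_braid // 1?eq_sym //; last by rewrite collC23 collC12.
rewrite (moveC x c) -{1}(moveV c x) -conjgE move_braid 1?eq_sym //; first exact: moveC.
by rewrite collC12 collC23.
Qed.

(** It suffices to realise [x,y] by a sequence starting at the end point [c] of [s]: directly if [c]
    is [x] or [y], as [c,d] if {c,x,y,d} is a line, and otherwise by the loop through [x] and
    [y]. *)
Lemma moves_mul_move a s x y : exists t, (moves B a s * mv x y)%g = moves B a t.
Proof.
pose c := last a s.
suff [t tE] : exists t, moves B c t = mv x y.
  exists (s ++ t); rewrite -tE /c; elim: s {c tE} a => [|d s IH] a /=; first by rewrite mul1g.
  by rewrite -mulgA IH.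
case: (eqVneq c x) => [->|cx]; first by exists [:: y]; rewrite /= mulg1.
case: (eqVneq c y) => [->|cy]; first by exists [:: x]; rewrite /= mulg1 moveC.
case: (eqVneq x y) => [->|xy]; first by exists [::]; rewrite move_refl.
case: (boolP (coll c x y)) => [/existsP[d cxyd]|cxy].
  exists [:: d]; rewrite /= mulg1; apply: move_same.
  by line_perm cxyd.
by exists [:: x; y; c]; rewrite /= mulg1 move_loop.
Qed.

Lemma moves_mul_moves a s b t : exists u, (moves B a s * moves B b t)%g = moves B a u.
Proof.
elim: t b s => [|c t IH] b s /=; first by exists s; rewrite mulg1.
have [s' E] := moves_mul_move a s b c.
by rewrite mulgA E; apply: IH.
Qed.

Lemma moves_aut a s : line_aut (moves B a s).
Proof.
elim: s a => [|b s IH] a /= x y z w; first by rewrite !perm1.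
by rewrite !permM IH move_aut.
Qed.

Lemma move_setP e : reflect (exists a b, a != b /\ e = mv a b) (e \in move_set B).
Proof.
apply: (iffP imsetP) => [[[a b]]|[a [b [ab ->]]]]; first by rewrite inE /=; exists a, b.
by exists (a, b); rewrite ?inE.
Qed.

Lemma moves_gen a s : moves B a s \in <<move_set B>>%g.
Proof.
elim: s a => [|b s IH] a /=; first exact: group1.
apply: groupM => //; case: (eqVneq a b) => [->|ab]; first by rewrite move_refl group1.
by apply/mem_gen/move_setP; exists a, b.
Qed.

(** * Orders of products of two moves *)

Lemma order_move a b : a != b -> #[mv a b]%g = 2.
Proof.
move=> ab; apply: nt_prime_order => //; first by rewrite expgS expg1 moveM.
by apply: contraNneq ab => E; rewrite -(move_l a b) E perm1.
Qed.

(** The cube is the product of [a,b][a,c][a,b] and [a,c][a,b][a,c], and both of these equal the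
    involution [b,c]. *)
Lemma order_move_mul3 a b c : a != b -> a != c -> b != c -> ~~ coll a b c ->
  ((mv a b * mv a c) ^+ 3 = 1)%g.
Proof.
move=> ab ac bc abc.
have E1 : (mv a c * mv a b * mv a c = mv b c)%g.
  have := @move_braid b a c; rewrite eq_sym collC12 (moveC b a) => /(_ ab bc abc) <-.
  by rewrite conjgE moveV mulgA.
have E2 : (mv a b * mv a c * mv a b = mv b c)%g.
  have := @move_braid c a b; rewrite eq_sym collC12 collC23 (moveC c a).
  rewrite (eq_sym c) => /(_ ac bc abc); rewrite (moveC c b) => <-.
  by rewrite conjgE moveV mulgA.
rewrite !expgS expg0 mulg1 !mulgA E2 -!mulgA (mulgA (mv a c)) E1.
exact: moveM.
Qed.

Lemma order_move_mul2 a b c d : (mv a b ^ mv c d)%g = mv a b ->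
  ((mv a b * mv c d) ^+ 2 = 1)%g.
Proof.
move=> E; rewrite expgS expg1 -{2}E conjgE moveV !mulgA.
rewrite -(mulgA (mv a b) (mv c d)) moveM mulg1 -(mulgA _ _ (mv c d)) -!mulgA moveM mulg1.
exact: moveM.
Qed.

Lemma order_in123 (gT : finGroupType) (x : gT) n :
  (x ^+ n = 1)%g -> n \in [:: 1; 2; 3] -> #[x]%g \in [:: 1; 2; 3].
Proof.
move/eqP; rewrite -order_dvdn => dv nE.
have n0 : 0 < n by case: n nE {dv}.
have := dvdn_leq n0 dv; have := order_gt0 x.
move: nE; rewrite !inE => /or3P[] /eqP->; by case: (#[x])%g => [|[|[|[|?]]]].
Qed.

(** By [move_moved] the second move may be renamed [a,a']. It then equals the first if b = a',
    commutes with it if a, a', b are collinear, and satisfies the braid relation otherwise. *)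
Lemma order_move_mul_moved a b c d : a != b -> mv c d a != a ->
  #[mv a b * mv c d]%g \in [:: 1; 2; 3].
Proof.
move=> ab ma; rewrite (move_moved ma); move: (mv c d a) ma => a' a'a {c d}.
case: (eqVneq b a') => [<-|ba'].
  by apply: (@order_in123 _ _ 1); rewrite // expg1 moveM.
case: (boolP (coll a a' b)) => [/existsP[b' L]|ncoll].
  apply: (@order_in123 _ _ 2) => //; apply: order_move_mul2.
  rewrite move_conj; last exact: move_aut.
  by rewrite move_l (move_line L); apply: move_same; line_perm L.
by apply: (@order_in123 _ _ 3) => //; apply: order_move_mul3; rewrite // 1?eq_sym // collC23.
Qed.

Lemma order_move_mul a b c d : a != b -> #[mv a b * mv c d]%g \in [:: 1; 2; 3].
Proof.
move=> ab; case: (eqVneq (mv c d a) a) => [fa|]; last exact: order_move_mul_moved.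
case: (eqVneq (mv c d b) b) => [fb|]; last first.
  by rewrite (moveC a b); apply: order_move_mul_moved; rewrite eq_sym.
apply: (@order_in123 _ _ 2) => //; apply: order_move_mul2.
by rewrite move_conj ?fa ?fb //; apply: move_aut.
Qed.

(** * The graph of noncollinear pairs at a fixed point *)

Hypothesis card_T : 2 * lam + 2 < #|T|.

(** Adjacency of [a] and [b] in the graph at [x]. The condition is symmetric in the three points, so
    it can be read in the graph at any one of them. *)
Definition apart x a b := [&& x != a, x != b, a != b & ~~ coll x a b].

Lemma apartC12 x a b : apart x a b = apart a x b.
Proof. by rewrite /apart collC12 (eq_sym x a); do 3 case: (_ != _). Qed.

Lemma apartC23 x a b : apart x a b = apart x b a.
Proof. by rewrite /apart collC23 (eq_sym a b) andbCA. Qed.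

Lemma card_apart x a : x != a -> #|[set b | apart x a b]| = #|T| - (2 * lam + 2).
Proof.
move=> xa; rewrite -(card_coll xa) -[2 in RHS](_ : #|[set x; a]| = 2); last by rewrite cards2 xa.
have <- : #|[set c | coll x a c] :|: [set x; a]| = #|[set c | coll x a c]| + #|[set x; a]|.
  rewrite cardsU; have -> : [set c | coll x a c] :&: [set x; a] = set0; last by rewrite cards0 subn0.
  apply/setP=> z; rewrite !inE; apply/negP => /andP[/coll_neq[_ xz az]].
  by rewrite eq_sym (negPf xz) eq_sym (negPf az).
rewrite -(cardsC ([set c | coll x a c] :|: [set x; a])) addKn.
apply: eq_card => z; rewrite !inE /apart xa.
by rewrite !negb_or (eq_sym z x) (eq_sym z a); case: (x == z); case: (a == z); case: coll.
Qed.

(* If no z existed, the points apart from (x, a) and from (x, b) would be two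
   disjoint subsets of the points apart from (a, b), all three of the same size. *)
Lemma exists_apart x a b : coll x a b -> exists z, apart x a z && apart x b z.
Proof.
move=> xab; have [xa xb ab] := coll_neq xab.
apply/existsP; apply: contraT; rewrite negb_exists => /forallP none.
pose N u v := [set z | apart u v z].
(* Parity on {x,a,b,z}: x, a, b are collinear, as are x, b, z, but x, a, z are not; hence a, b, z
   are not. *)
have par z : apart x a z -> ~~ apart x b z -> apart a b z.
  case/and4P=> _ xz az xaz; rewrite /apart xb xz ab az /=.
  case: (eqVneq b z) => [bz|bz /=]; first by rewrite -bz xab in xaz.
  have u : uniq [:: x; a; b; z] by rewrite /= !inE !negb_or xa xb xz ab az bz.
  by have := two_graph_parity u; rewrite xab (negPf xaz); case: (coll x b z); case: coll.
have par' z : apart x b z -> ~~ apart x a z -> apart a b z.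
  case/and4P=> _ xz bz xbz; rewrite /apart xa xz ab bz /=.
  case: (eqVneq a z) => [az|az /=]; first by rewrite -az collC23 xab in xbz.
  have u : uniq [:: x; a; b; z] by rewrite /= !inE !negb_or xa xb xz ab az bz.
  by have := two_graph_parity u; rewrite xab (negPf xbz); case: (coll x a z); case: coll.
have sub : N x a :|: N x b \subset N a b.
  apply/subsetP=> z; have := none z; rewrite !inE.
  by case: (boolP (apart x a z)) (par z) (par' z) => // _; case: (apart x b z) => //= p1 p2 _ _; auto.
have := subset_leq_card sub; rewrite cardsU.
have -> : N x a :&: N x b = set0.
  by apply/setP=> z; rewrite !inE; apply/negbTE/none.
have k_gt0 : 0 < #|T| - (2 * lam + 2) by rewrite subn_gt0.
rewrite cards0 subn0 !card_apart //.
by rewrite -[X in _ <= X]addn0 leq_add2l leqNgt k_gt0.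
Qed.

(** * The group of move sequences and its point stabilizers *)

Variable (G : {group {perm T}}) (inf : T).
Hypothesis G_def : forall g, g \in G <-> exists s, g = moves B inf s.

Lemma move_in a b : mv a b \in G.
Proof.
by apply/G_def; have [t] := moves_mul_move inf [::] a b; rewrite mul1g; exists t.
Qed.

Lemma line_aut_G g : g \in G -> line_aut g.
Proof. by case/G_def=> s ->; apply: moves_aut. Qed.

Lemma move_fix_apart x a b : apart x a b -> mv a b x = x.
Proof.
case/and4P=> xa xb ab xab; apply: move_fix => //.
by rewrite collC23 collC12.
Qed.

Lemma not_apart_coll x a b : x != a -> x != b -> a != b -> ~~ apart x a b -> coll x a b.
Proof. by rewrite /apart => -> -> ->; rewrite negbK. Qed.

(** Adjacent points are exchanged by a move fixing [x]; nonadjacent ones have a common neighbour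
    [z], and two such moves lead through [z]. *)
Lemma stab_trans x a b : x != a -> x != b -> exists g, [/\ g \in G, g x = x & g a = b].
Proof.
move=> xa xb; case: (eqVneq a b) => [<-|ab].
  by exists 1%g; rewrite group1 !perm1.
case: (boolP (apart x a b)) => [xab|/not_apart_coll].
  by exists (mv a b); rewrite move_in move_fix_apart ?move_l.
case/(_ xa xb ab)/exists_apart => z /andP[xaz xbz].
exists (mv a z * mv z b)%g; rewrite groupM ?move_in // !permM move_l move_l.
by rewrite !move_fix_apart // apartC23.
Qed.

(** * Blocks of a point stabilizer *)

Section Block.
Variables (x : T) (D : {set T}).
Hypothesis xD : x \notin D.
Hypothesis D_block : forall g u v, g \in G -> g x = x ->
  u \in D -> g u \in D -> v \in D -> g v \in D.

Lemma block_neq u : u \in D -> x != u.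
Proof. by apply: contraTneq => <-. Qed.

(** The move [a,b] fixes [x] and takes [a] out of [D], so it cannot fix [c] in [D]; hence a, b, c
    are collinear. Parity on {x,a,b,c} then makes exactly one of x, a, c and x, b, c collinear. *)
Lemma block_apart a b c : a \in D -> b \notin D -> apart x a b -> c \in D -> c != a ->
  apart x a c = ~~ apart x b c.
Proof.
move=> aD bD xab cD ca; have cb : c != b by apply: contraNneq bD => <-.
have /and4P[xa xb ab nxab] := xab; have xc := block_neq cD.
have abc : coll a b c.
  apply: contraT => nabc; case/negP: bD; rewrite -(move_l a b).
  by apply: (@D_block _ c) => //; [exact: move_in | exact: move_fix_apart | rewrite move_fix].
have u : uniq [:: x; a; b; c].
  by rewrite /= !inE !negb_or xa xb xc ab eq_sym ca eq_sym cb.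
have := two_graph_parity u.
rewrite /apart xa xb xc abc (negPf nxab) eq_sym ca eq_sym cb /=.
by case: (coll x a c); case: (coll x b c).
Qed.

(** A path of length at most two from [a] to [c] has an edge leaving [D]. *)
Lemma block_boundary a c : a \in D -> c \notin D -> c != x ->
  exists e b, [/\ e \in D, b \notin D & apart x e b].
Proof.
move=> aD cD cx; have xa := block_neq aD.
case: (boolP (apart x a c)) => [xac|/not_apart_coll]; first by exists a, c.
have ac : a != c by apply: contraNneq cD => <-.
rewrite eq_sym in cx; case/(_ xa cx ac)/exists_apart => z /andP[xaz xcz].
case: (boolP (z \in D)) => zD; last by exists a, z.
by exists z, c; rewrite apartC23.
Qed.

(* When x, a, b are collinear, the loop [x,a][a,b][b,x] fixes the line through
   them pointwise and sends e to [a,b]e, a second neighbour of b in the block. *)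
Lemma block_twins e b a : e \in D -> b \notin D -> apart x e b -> a \in D -> a != e ->
  exists e', [/\ e' \in D, e' != e, apart x e' b & ~~ apart x e e'].
Proof.
move=> eD bD xeb aD ae; have := block_apart eD bD xeb aD ae.
case: (boolP (apart x a b)) => [xab|nxab] xea.
  by exists a; rewrite aD ae xab xea apartC23 xab.
rewrite (apartC23 x b a) nxab /= in xea.
have /and4P[xe xb eb nxeb] := xeb; have xa := block_neq aD.
have ab : a != b by apply: contraNneq bD => <-.
have xab : coll x a b by apply: not_apart_coll.
have /existsP[c xabc] := xab.
have /and4P[_ _ ea nxea] := xea.
have abe : coll a b e.
  have u : uniq [:: x; a; b; e].
    by rewrite /= !inE !negb_or xa xb xe ab ae eq_sym eb.
  have := two_graph_parity u; rewrite xab collC23 (negPf nxea).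
  by rewrite (collC23 x b e) (negPf nxeb); case: coll.
have /existsP[e' abee'] := abe; have [_ _ ae' _ [be' ee']] := line_neq abee'.
have xe' : x != e'.
  apply: contraNneq nxea => xE; apply: (@line_coll _ _ _ b).
  by rewrite xE; line_perm abee'.
(* As {x,a,b,c} is a line, [b,x] = [a,c]; this move fixes [e] because b, x, e are not collinear. *)
have nace : ~~ coll a c e.
  apply/negP=> /existsP[w acew].
  have [_ _ _ _ [_ ew]] := line_neq acew.
  have : mv b x e = e.
    by rewrite moveC -{2}(@move_fix_apart e x b) // apartC12.
  rewrite (@move_same b x a c); last by line_perm xabc.
  by rewrite (move_line acew) => /eqP; rewrite eq_sym (negPf ew).
have mx : mv a b x = c by apply: move_line; line_perm xabc.
(* The automorphism [a,b] takes b, x, e' to a, c, e. *)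
have nbxe' : ~~ coll b x e'.
  rewrite -(line_aut_coll _ _ _ (@move_aut a b)) move_r mx.
  by rewrite (@move_line a b e' e) // lineC34.
have xbe' : apart x e' b by rewrite apartC23 /apart xb xe' be' collC12.
exists e'; rewrite xbe' eq_sym ee'; suff e'D : e' \in D.
  rewrite e'D; split=> //.
  by rewrite (block_apart eD bD xeb) // 1?eq_sym // apartC23 xbe'.
pose h := (mv x a * (mv a b * mv b x))%g.
have hG : h \in G by rewrite !groupM ?move_in.
have hx : h x = x by rewrite !permM !move_l.
have ha : h a = a.
  by rewrite !permM move_r mx; apply: move_line; line_perm xabc.
have <- : h e = e'.
  rewrite !permM (@move_fix_apart e x a); last by rewrite apartC12.
  by rewrite (move_line abee') move_fix // eq_sym.
by apply: (@D_block h a); rewrite // ha.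
Qed.

(** Take nonadjacent [e], [e'] in [D] with a common neighbour outside. Applying [exists_apart] at
    [e] gives a neighbour [z] of [e] with e, e', z not collinear. Whether [z] lies in [D] or not,
    [block_apart] makes it a neighbour of [e'] too, and then x, e, e' is the only collinear triple
    in {x,e,e',z}, against parity. *)
Lemma no_block a a' c : a \in D -> a' \in D -> a != a' -> c \notin D -> c != x -> False.
Proof.
move=> aD a'D aa' cD cx; have [e [b [eD bD xeb]]] := block_boundary aD cD cx.
have [f fD fe] : exists2 f, f \in D & f != e.
  by case: (eqVneq a e) => [<-|]; [exists a'; rewrite // eq_sym | exists a].
have [e' [e'D e'e xe'b nxee']] := block_twins eD bD xeb fD fe.
have xe := block_neq eD; have xe' := block_neq e'D.
have xee' : coll x e e' by apply: not_apart_coll; rewrite // eq_sym.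
have := xee'; rewrite collC12 => /exists_apart[z /andP[]].
rewrite apartC12 => xez ee'z.
have /and4P[_ xz ez nxez] := xez; have /and4P[ee' _ e'z nee'z] := ee'z.
have xe'z : apart x e' z.
  case: (boolP (z \in D)) => zD.
    have := block_apart eD bD xeb zD; rewrite eq_sym xez => /(_ ez) xbz.
    by rewrite (block_apart e'D bD xe'b zD) -?xbz // eq_sym.
  have := block_apart eD zD xez e'D e'e.
  by rewrite (negPf nxee') apartC23 => /esym/negbFE.
have /and4P[_ _ _ nxe'z] := xe'z.
have u : uniq [:: x; e; e'; z].
  by rewrite /= !inE !negb_or xe xe' xz ee' ez e'z.
have := two_graph_parity u.
by rewrite xee' (negPf nxez) (negPf nxe'z) (negPf nee'z).
Qed.

End Block.

(** * Primitivity, centre, conjugacy class and 3-transpositions *)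

Lemma exists_third (x y : T) : exists z, x != z /\ z != y.
Proof.
have : ~: [set x; y] != set0.
  rewrite -card_gt0 cardsCs setCK subn_gt0 cards2.
  apply: leq_ltn_trans card_T; apply: leq_trans (leq_addl _ _).
  by case: (x != y).
by case/set0Pn=> z; rewrite !inE negb_or => /andP[zx zy]; exists z; rewrite eq_sym.
Qed.

Lemma two_primitive_G : two_primitive G.
Proof.
have in_orbit (H : {set {perm T}}) (a b : T) g :
    g \in H -> g a = b -> b \in orbit 'P H a.
  by move=> gH <-; apply/imsetP; exists g.
split=> [|x].
  apply/imsetP; exists inf; rewrite ?inE //; apply/setP=> a; rewrite inE; apply/esym.
  by apply: (in_orbit _ _ _ (mv inf a)); rewrite ?move_in ?move_l.
have memC g : (g \in 'C_G[x | 'P]%g) = (g \in G) && (g x == x).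
  by rewrite inE; congr andb; apply/astab1P/eqP.
apply/andP; split.
  have [a [_ ax]] := exists_third x x.
  apply/imsetP; exists a; rewrite ?inE //; apply/setP=> b; rewrite !inE.
  apply/idP/imsetP=> [bx|[g]].
    rewrite eq_sym in ax; rewrite eq_sym in bx.
    have [g [gG gx gab]] := stab_trans ax bx.
    by exists g; rewrite ?memC ?gG ?gx ?eqxx.
  rewrite memC => /andP[_ /eqP gx] ->; rewrite -[X in _ != X]gx /= /aperm.
  by rewrite (inj_eq perm_inj).
rewrite negb_exists; apply/forallP=> Q; apply/negP=> /and3P[parQ actQ /andP[Q1 Q2]].
have /and3P[/eqP covQ trQ Q0] := parQ.
(* A system of imprimitivity has fewer blocks than points, so some block has two points, and more
   than one block, so some point other than [x] lies outside it. *)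
have [D DQ D2] : exists2 D, D \in Q & 1 < #|D|.
  apply/exists_inP; apply: contraLR Q2; rewrite negb_exists_in => /forall_inP small.
  rewrite -leqNgt (card_partition parQ) -sum1_card; apply: leq_sum => D /small.
  by rewrite -leqNgt.
have sub A : A \in Q -> A \subset [set~ x].
  by move=> AQ; rewrite -covQ; apply: bigcup_sup.
have xD : x \notin D by apply/negP=> /(subsetP (sub D DQ)); rewrite !inE eqxx.
have [D' D'Q D'D] : exists2 D', D' \in Q & D' != D.
  apply/exists_inP; apply: contraLR Q1; rewrite negb_exists_in => /forall_inP same.
  rewrite -leqNgt -(cards1 D) subset_leq_card //; apply/subsetP=> A /same.
  by rewrite negbK inE.
have /set0Pn[c cD'] : D' != set0 by apply: contraNneq Q0 => <-.
have cD : c \notin D.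
  have /trivIsetP/(_ D' D D'Q DQ D'D) := trQ.
  by rewrite disjoint_sym => /disjointFl -> .
have cx : c != x by have := subsetP (sub _ D'Q) _ cD'; rewrite !inE.
have /card_gt1P[a [a' [aD a'D aa']]] := D2.
apply: (@no_block x D xD _ a a' c) => // g u v gG gx uD guD vD.
have gC : g \in 'C_G[x | 'P]%g by rewrite memC gG gx eqxx.
have DgQ : ('P^*)%act D g \in Q by rewrite (actsP actQ).
(* The image of [D] is a block of [Q] that shares the point [g u] with [D]. *)
suff <- : ('P^*)%act D g = D by apply/imsetP; exists v.
apply/eqP; apply: contraT => ne; have /trivIsetP/(_ _ _ DgQ DQ ne) := trQ.
move/disjoint_setI0/setP/(_ (g u)); rewrite !inE guD andbT => /negbT/negP[].
by apply/imsetP; exists u.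
Qed.

(** If a central [z] moved [x], an element fixing [x] and moving [z x] to a third point would fail
    to commute with [z]. *)
Lemma center_G : ('Z(G) = 1)%g.
Proof.
apply/trivgP/subsetP=> z /centerP[zG zC]; rewrite inE; apply/eqP/permP=> x.
rewrite perm1; apply/eqP; apply: contraT => zx; rewrite eq_sym in zx.
have [y [xy yz]] := exists_third x (z x).
have [g [gG gx gz]] := stab_trans zx xy.
have := congr1 (fun s : {perm T} => s x) (zC g gG); rewrite !permM gx gz => /eqP.
by rewrite (negPf yz).
Qed.

(** To reach [c,d] from [inf,a], conjugate first by [inf,c], which takes [inf] to [c], and then by
    an element fixing [c] that takes the image of [a] to [d]. *)
Lemma class_G : move_set B \in classes G.
Proof.
have [a [ia _]] := exists_third inf inf.
apply/imsetP; exists (mv inf a); first exact: move_in.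
apply/setP=> e; apply/move_setP/imsetP=> [[c [d [cd ->]]]|[g gG ->]].
  have [|g [gG gc gd]] := @stab_trans c (mv inf c a) d _ cd.
    by rewrite -{1}(move_l inf c) (inj_eq perm_inj).
  have hG : (mv inf c * g)%g \in G by rewrite groupM ?move_in.
  exists (mv inf c * g)%g => //.
  by rewrite move_conj; [rewrite !permM move_l gc gd | apply: line_aut_G].
exists (g inf), (g a); rewrite (inj_eq perm_inj) ia move_conj //; exact: line_aut_G.
Qed.

Lemma three_transposition_G : three_transposition_group G (move_set B).
Proof.
split.
- apply/eqP; rewrite eqEsubset gen_subG; apply/andP; split; apply/subsetP=> g.
    by case/G_def=> s ->; apply: moves_gen.
  by case/move_setP=> a [b [_ ->]]; apply: move_in.
- by move=> _ /move_setP[a [b [ab ->]]]; apply: order_move.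
- move=> g _ gG /move_setP[a [b [ab ->]]]; apply/move_setP; exists (g a), (g b).
  by rewrite (inj_eq perm_inj) move_conj //; apply: line_aut_G.
by move=> _ _ /move_setP[a [b [ab ->]]] /move_setP[c [d [_ ->]]]; apply: order_move_mul.
Qed.

End Lines.

Theorem corollary4p7 (T : finType) (B : {set {set T}}) (lam : nat) (inf : T)
    (G : {set {perm T}}) :
  design_2_4 B lam ->
  supersimple B ->
  prop_triangle B ->
  regular_two_graph (collinear_triples B) ->
  2 * lam + 2 < #|T| ->
  (forall g, g \in G <-> exists s : seq T, g = moves B inf s) ->
  [/\ three_transposition_group G (move_set B),
      two_primitive G,
      'Z(G)%g = 1%g &
      move_set B \in classes G].
Proof.
move=> dB sB tB rB cT GE.
(* In a finite group, containing 1 and being closed under products suffices; the empty sequence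
   gives 1. *)
have gG : group_set G.
  apply/group_setP; split=> [|g h /GE[s ->] /GE[t ->]]; first by apply/GE; exists [::].
  by apply/GE; apply: moves_mul_moves dB sB tB rB _ _ _ _.
have GE' : forall g, g \in Group gG <-> exists s : seq T, g = moves B inf s := GE.
split.
- exact: three_transposition_G dB sB tB rB _ _ GE'.
- exact: two_primitive_G dB sB tB rB cT _ _ GE'.
- exact: center_G dB sB tB rB cT _ _ GE'.
exact: class_G dB sB tB rB cT _ _ GE'.
Qed.
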